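(* Let $\mathbb{P}$ be a partition of $\Omega$ and let $P$ be a dF-coherent probability on $\mathcal{A}_C(\mathbb{P})$. a) Let $C|D$ be a conditional event with $C|D\neq\varnothing|D$ and $C|D\neq D|D$. The dF-coherent extensions of $P$ to the additional event $C|D$ are those and only those with $P(C|D)$ in the closed interval $[P((C|D)_* ),\,P((C|D)^* )]$. b) Let $\mathcal{E}$ be an arbitrary set of conditional events, each satisfying $C|D\neq\varnothing|D$ and $C|D\neq D|D$. The extension $\underline P$ of $P$ to $\mathcal{A}_C(\mathbb{P})\cup\mathcal{E}$ given by $\underline P(C|D)=P((C|D)_* )$ for all $C|D\in\mathcal{E}$ is a W-coherent lower probability, and the extension $\overline P$ of $P$ to $\mathcal{A}_C(\mathbb{P})\cup\mathcal{E}$ given by $\overline P(C|D)=P((C|D)^* )$ for all $C|D\in\mathcal{E}$ is a W-coherent upper probability.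
   Context: Events are subsets of a nonempty set $\Omega$ (the sure event); $\wedge,\vee,\neg$ denote intersection, union, complement; $\Rightarrow$ denotes inclusion; an event is identified with its indicator function. A gamble is a bounded function $X:\Omega\to\mathbb{R}$. For an event $B\neq\varnothing$, the conditional gamble $X|B$ is the restriction of $X$ to $B$ (so two conditional gambles with the same $B$ and the same restriction are identified); $\sup(X|B)=\sup_{\omega\in B}X(\omega)$. A conditional event $A|B$ ($B\ne\varnothing$) is the conditional gamble $I_A|B$; in particular $A|B=A\wedge B|B$. Consistency notions, for a set $\mathcal{S}$ of conditional gambles. A map $P:\mathcal{S}\to\mathbb{R}$ is dF-coherent iff for all $n\in\mathbb{N}$, all $X_1|B_1,\dots,X_n|B_n\in\mathcal{S}$ and all $s_1,\dots,s_n\in\mathbb{R}$, with $G=\sum_{i=1}^n s_iB_i(X_i-P(X_i|B_i))$ and $B=\bigvee_{i=1}^n B_i$, one has $\sup(G|B)\ge 0$. A map $\underline P:\mathcal{S}\to\mathbb{R}$ (lower prevision) is W-coherent iff for all $n\in\mathbb{N}$, all $X_0|B_0,\dots,X_n|B_n\in\mathcal{S}$ and all real $s_0,\dots,s_n\ge 0$, setting $B=\bigvee_{i=0}^n B_i$ and $\underline G=\sum_{i=1}^n s_iB_i(X_i-\underline P(X_i|B_i))-s_0B_0(X_0-\underline P(X_0|B_0))$, one has $\sup(\underline G|B)\ge 0$. A map $\overline P:\mathcal{S}\to\mathbb{R}$ (upper prevision) is W-coherent iff the lower prevision $-X|B\mapsto-\overline P(X|B)$ on $\{-X|B: X|B\in\mathcal{S}\}$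 is. These are called (precise, lower, upper) probabilities when all elements of $\mathcal{S}$ are conditional events. A partition $\mathbb{P}$ is a set of pairwise disjoint nonempty events with union $\Omega$; $\mathcal{A}(\mathbb{P})$ is the set of all unions of elements of $\mathbb{P}$; $\mathcal{A}_C(\mathbb{P})=\{A|B: A,B\in\mathcal{A}(\mathbb{P}),\,B\ne\varnothing\}$. For an event $E$: $E_*=\bigvee_{e\in\mathbb{P}:\,e\Rightarrow E}e$ and $E^*=\bigvee_{e\in\mathbb{P}:\,e\wedge E\ne\varnothing}e$. For a conditional event $C|D$ with $C|D\neq\varnothing|D$, $C|D\ne D|D$: $(C|D)_*=(C\wedge D)_*\,|\,[(C\wedge D)_*\vee(\neg C\wedge D)^*]$ and $(C|D)^*=(C\wedge D)^*\,|\,[(C\wedge D)^*\vee(\neg C\wedge D)_*]$; both belong to $\mathcal{A}_C(\mathbb{P})$. *)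

(* Defs.v *)
From mathcomp Require Import all_boot all_order all_algebra.
From mathcomp Require Import all_classical all_reals all_analysis.
Set Implicit Arguments.
Unset Strict Implicit.
Unset Printing Implicit Defensive.
Import Order.TTheory GRing.Theory Num.Theory.
Import numFieldNormedType.Exports.
Local Open Scope classical_set_scope.
Local Open Scope ring_scope.

(* X|B is the restriction of X to B.  It is stored through its extension by 0
   outside B, so that Leibniz equality is exactly the identification of
   conditional gambles having the same B and the same restriction to B. *)
Record cgamble (R : realType) (Omega : Type) := CGamble {
  cg_on : set Omega ;
  cg_fun : Omega -> R ;
  cg_on_neq0 : cg_on !=set0 ;
  cg_bounded : bounded_fun cg_fun ;
  cg_off : forall w, ~ cg_on w -> cg_fun w = 0 }.

Section ConditionalGambles.
Context {R : realType} {Omega : Type}.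
Implicit Types (X : Omega -> R) (A B C D : set Omega).

Lemma bounded_fun_ex X : bounded_fun X <-> exists M, forall w, `|X w| <= M.
Proof.
split=> [/pinfty_ex_gt0[M _ XM]|[M XM]]; first by exists M => w; apply: XM.
exists M; split; first exact: num_real.
by move=> M' /ltW MM' w _; apply: le_trans (XM w) MM'.
Qed.

Lemma patch0_bounded X B : bounded_fun X -> bounded_fun (patch (cst 0) B X).
Proof.
move=> /bounded_fun_ex[M XM]; apply/bounded_fun_ex; exists `|M| => w.
rewrite /patch; case: ifP => _ /=; last by rewrite normr0.
by apply: le_trans (XM w) (ler_norm M).
Qed.

Lemma patch0_off X B w : ~ B w -> patch (cst 0) B X w = 0.
Proof. by move=> nBw; rewrite /patch memNset. Qed.

Definition condg X (hX : bounded_fun X) B (hB : B !=set0) : cgamble R Omega :=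
  CGamble hB (patch0_bounded B hX) (@patch0_off X B).

Lemma indic_bounded A : bounded_fun (\1_A : Omega -> R).
Proof.
apply/bounded_fun_ex; exists 1 => w; rewrite indicE.
by case: (w \in A); rewrite ?normr1 ?normr0 ?ler01.
Qed.

Definition cevent A B (hB : B !=set0) : cgamble R Omega :=
  condg (indic_bounded A) hB.

Lemma opp_bounded X : bounded_fun X -> bounded_fun (fun w => - X w).
Proof.
move=> /bounded_fun_ex[M XM]; apply/bounded_fun_ex; exists M => w.
by rewrite normrN; apply: XM.
Qed.

Definition cg_opp (x : cgamble R Omega) : cgamble R Omega :=
  condg (opp_bounded (@cg_bounded R Omega x)) (cg_on_neq0 x).

(* A map P : S -> R is given as a function on all conditional gambles, of which
   only the values on S are ever used. *)

(* B (X - P(X|B)), for x = X|B. *)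
Definition gain (P : cgamble R Omega -> R) (x : cgamble R Omega) (w : Omega)
    : R :=
  \1_(cg_on x) w * (cg_fun x w - P x).

(* The gains are bounded and the joint conditioning events nonempty, so the
   real supremum below is the genuine one. *)
Definition dF_coherent (S : set (cgamble R Omega)) (P : cgamble R Omega -> R)
    : Prop :=
  forall (n : nat) (x : 'I_n -> cgamble R Omega) (s : 'I_n -> R),
    (0 < n)%N -> (forall i, S (x i)) ->
    let G := fun w => \sum_(i < n) s i * gain P (x i) w in
    let B := \bigcup_(i in [set: 'I_n]) cg_on (x i) in
    0 <= sup (G @` B).

Definition W_coherent_lower (S : set (cgamble R Omega))
    (P : cgamble R Omega -> R) : Prop :=
  forall (n : nat) (x0 : cgamble R Omega) (x : 'I_n -> cgamble R Omega)
         (s0 : R) (s : 'I_n -> R),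
    (0 < n)%N -> S x0 -> (forall i, S (x i)) ->
    0 <= s0 -> (forall i, 0 <= s i) ->
    let G := fun w => \sum_(i < n) s i * gain P (x i) w - s0 * gain P x0 w in
    let B := cg_on x0 `|` \bigcup_(i in [set: 'I_n]) cg_on (x i) in
    0 <= sup (G @` B).

(* [cg_opp] is an involution: the lower prevision maps - X|B to - P (X|B). *)
Definition W_coherent_upper (S : set (cgamble R Omega))
    (P : cgamble R Omega -> R) : Prop :=
  W_coherent_lower (cg_opp @` S) (fun y => - P (cg_opp y)).

Definition extends (S : set (cgamble R Omega)) (P Q : cgamble R Omega -> R)
    : Prop :=
  forall c, S c -> Q c = P c.

Definition nontrivial C D (hD : D !=set0) : Prop :=
  cevent C hD <> cevent set0 hD /\ cevent C hD <> cevent D hD.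

Lemma cevent_eq A A' B (hB : B !=set0) :
  A `&` B = A' `&` B -> cevent A hB = cevent A' hB.
Proof.
move=> AA'; rewrite /cevent /condg.
have e : patch (cst 0) B (\1_A) = patch (cst 0) B (\1_A') :> (Omega -> R).
  apply/funext => w; rewrite /patch; case: ifPn => // /set_mem Bw.
  rewrite !indicE; congr (_ %:R); congr nat_of_bool; apply/idP/idP => /set_mem H.
  - have : (A `&` B) w by split.
    by rewrite AA' => -[? _]; rewrite inE.
  - have : (A' `&` B) w by split.
    by rewrite -AA' => -[? _]; rewrite inE.
move: (patch0_bounded _ _) (patch0_bounded _ _) (@patch0_off _ _)
  (@patch0_off _ _); rewrite e => b b' o o'.
by congr CGamble; apply: Prop_irrelevance.
Qed.

Lemma nontrivial_setI C D (hD : D !=set0) :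
  nontrivial C hD -> C `&` D !=set0.
Proof.
move=> [C0 _]; apply/set0P/eqP => CD0.
by apply: C0; apply: cevent_eq; rewrite set0I.
Qed.

Lemma nontrivial_setCI C D (hD : D !=set0) :
  nontrivial C hD -> ~` C `&` D !=set0.
Proof.
move=> [_ CD]; apply/set0P/eqP => nCD0; apply: CD; apply: cevent_eq.
rewrite setIid; apply/seteqP; split=> [w []//|w Dw]; split=> //.
by apply: contrapT => nCw; have : (~` C `&` D) w by []; rewrite nCD0.
Qed.

End ConditionalGambles.

Section Partitions.
Context {Omega : Type}.
Implicit Types (PP : set (set Omega)) (E C D : set Omega).

Definition unions PP : set (set Omega) :=
  [set E | exists2 F, F `<=` PP & E = \bigcup_(e in F) e].

Definition inner PP E : set Omega :=
  \bigcup_(e in [set e | PP e /\ e `<=` E]) e.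

Definition outer PP E : set Omega :=
  \bigcup_(e in [set e | PP e /\ e `&` E !=set0]) e.

Lemma outer_neq0 PP E : partition PP id [set: Omega] ->
  E !=set0 -> outer PP E !=set0.
Proof.
move=> [cov _ _] [w Ew].
have : cover PP id w by rewrite cov.
by move=> [e Pe ew]; exists w, e => //; split=> //; exists w.
Qed.

End Partitions.

Section ConditionalEvents.
Context {R : realType} {Omega : Type}.
Variables (PP : set (set Omega)) (hPP : partition PP id [set: Omega]).
Implicit Types (C D : set Omega).

Definition ACset : set (cgamble R Omega) :=
  [set c | exists A B (hB : B !=set0),
    [/\ unions PP A, unions PP B & c = cevent A hB]].

Definition cinner_on C D : set Omega :=
  inner PP (C `&` D) `|` outer PP (~` C `&` D).

Definition couter_on C D : set Omega :=
  outer PP (C `&` D) `|` inner PP (~` C `&` D).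

Lemma cinner_on_neq0 C D (hD : D !=set0) :
  nontrivial (R:=R) C hD -> cinner_on C D !=set0.
Proof.
by move=> /nontrivial_setCI /(outer_neq0 hPP) [w ?]; exists w; right.
Qed.

Lemma couter_on_neq0 C D (hD : D !=set0) :
  nontrivial (R:=R) C hD -> couter_on C D !=set0.
Proof.
by move=> /nontrivial_setI /(outer_neq0 hPP) [w ?]; exists w; left.
Qed.

Definition cinner C D (hD : D !=set0) (h : nontrivial C hD) : cgamble R Omega :=
  cevent (inner PP (C `&` D)) (cinner_on_neq0 h).

Definition couter C D (hD : D !=set0) (h : nontrivial C hD) : cgamble R Omega :=
  cevent (outer PP (C `&` D)) (couter_on_neq0 h).

Definition inner_extension (P : cgamble R Omega -> R)
    (E : set (cgamble R Omega)) (Q : cgamble R Omega -> R) : Prop :=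
  extends ACset P Q /\
  forall C D (hD : D !=set0) (h : nontrivial C hD),
    E (cevent C hD) -> Q (cevent C hD) = P (cinner h).

Definition outer_extension (P : cgamble R Omega -> R)
    (E : set (cgamble R Omega)) (Q : cgamble R Omega -> R) : Prop :=
  extends ACset P Q /\
  forall C D (hD : D !=set0) (h : nontrivial C hD),
    E (cevent C hD) -> Q (cevent C hD) = P (couter h).

End ConditionalEvents.

Arguments ACset R {Omega} PP.

(* Main.v *)
Require Import Defs.
From mathcomp Require Import all_boot all_order all_algebra.
From mathcomp Require Import all_classical all_reals all_analysis.
From mathcomp Require Import lra.
Import Order.TTheory GRing.Theory Num.Theory.
Local Open Scope classical_set_scope.
Local Open Scope ring_scope.

(** Replacing a bet on [C|D] by the bet on its inner event, the conditional
event written with a lower star, at the same price and with a nonnegative stake,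
never increases the gain, and the new gain is constant on the blocks of the
partition. Coherence of [P] yields a block on which the new bets, together with
the bet against the inner event of [C0|D0], do not lose; it remains to find in
this block a point of the original conditioning events. If every such point
favours [C0|D0], then the bet against its inner event is called off on the block
and all other active bets lose their price there. Since bets with zero stake or
zero price cannot lose there and are discarded beforehand, the total would be
negative. The outer event is handled by passing from [C|D] to [~C|D], whose
inner event is the complement of the outer event of [C|D]. *)

(** * Blocks of the partition as classes of an equivalence relation *)

Section Blocks.
Context {Omega : Type} {PP : set (set Omega)}.
Context (hPP : partition PP id [set: Omega]).
Implicit Types (A B C D E : set Omega) (w : Omega).

(** Over the classes of this relation [inner] and [outer] become a universal and an existential
    quantifier; see [innerP] and [outerP]. *)
Definition same_block w w' : Prop := exists2 e, PP e & e w /\ e w'.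

(** Pointwise form of membership in the algebra of unions of blocks; see [unionsP]. *)
Definition saturated A : Prop := forall w w', same_block w w' -> A w -> A w'.

Lemma same_block_refl w : same_block w w.
Proof.
case: hPP => cov _ _; have : cover PP id w by rewrite cov.
by move=> [e Pe ew]; exists e.
Qed.

Lemma same_block_sym w w' : same_block w w' -> same_block w' w.
Proof. by move=> [e Pe [ew ew']]; exists e. Qed.

Lemma eq_block e e' w : PP e -> PP e' -> e w -> e' w -> e = e'.
Proof.
by case: hPP => _ tri _ Pe Pe' ew e'w; apply: tri => //; exists w.
Qed.

Lemma same_block_trans w w' w'' :
  same_block w w' -> same_block w' w'' -> same_block w w''.
Proof.
move=> [e Pe [ew ew']] [e' Pe' [e'w' e'w'']].
have ee' := eq_block e e' w' Pe Pe' ew' e'w'.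
by exists e => //; rewrite [e in e w'']ee'.
Qed.

Lemma innerP E w : inner PP E w <-> forall w', same_block w w' -> E w'.
Proof.
split=> [[e [Pe eE] ew] w' [e' Pe' [e'w e'w']]|H].
  by apply: eE; rewrite (eq_block e e' w).
have [e Pe [ew _]] := same_block_refl w.
by exists e => //; split=> // w' ew'; apply: H; exists e.
Qed.

Lemma outerP E w : outer PP E w <-> exists2 w', same_block w w' & E w'.
Proof.
split=> [[e [Pe [w' [ew' Ew']]] ew]|[w' [e Pe [ew ew']] Ew']].
  by exists w' => //; exists e.
by exists e => //; split=> //; exists w'.
Qed.

Lemma saturated_inner E : saturated (inner PP E).
Proof.
move=> w w' ww' /innerP H; apply/innerP => w'' w'w''.
by apply: H; apply: same_block_trans w'w''.
Qed.

Lemma saturated_outer E : saturated (outer PP E).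
Proof.
move=> w w' /same_block_sym w'w /outerP[w'' ww'' Ew''].
by apply/outerP; exists w'' => //; apply: same_block_trans ww''.
Qed.

Lemma saturatedU A B : saturated A -> saturated B -> saturated (A `|` B).
Proof. by move=> sA sB w w' /[dup] /sA A' /sB B' [/A'|/B']; [left|right]. Qed.

Lemma saturatedC A : saturated A -> saturated (~` A).
Proof. by move=> sA w w' /same_block_sym /sA A' nA /A'. Qed.

Lemma saturatedI A B : saturated A -> saturated B -> saturated (A `&` B).
Proof. by move=> sA sB w w' /[dup] /sA A' /sB B' [/A' ? /B' ?]. Qed.

Lemma inner_saturated A : saturated A -> inner PP A = A.
Proof.
move=> sA; apply/seteqP; split=> w.
  by move=> /innerP; apply; apply: same_block_refl.
by move=> Aw; apply/innerP => w' ww'; apply: sA Aw.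
Qed.

Lemma outer_saturated A : saturated A -> outer PP A = A.
Proof.
move=> sA; apply/seteqP; split=> w.
  by move=> /outerP[w' ww' Aw']; apply: sA Aw'; apply: same_block_sym.
by move=> Aw; apply/outerP; exists w => //; apply: same_block_refl.
Qed.

Lemma unionsP A : unions PP A <-> saturated A.
Proof.
split=> [[F FPP ->] w w' [e Pe [ew ew']] [f Ff fw]|sA].
  by exists f => //; rewrite (eq_block f e w) //; apply: FPP.
exists [set e | PP e /\ e `<=` A]; first by move=> e [].
by rewrite -{1}(inner_saturated A sA).
Qed.

Lemma saturated_cinner_on C D : saturated (cinner_on PP C D).
Proof. by apply: saturatedU; [exact: saturated_inner|exact: saturated_outer]. Qed.

(** Both approximations are exact on unions of blocks, so events of [ACset] are their own inner
    events and can be treated along with the new ones. *)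
Lemma cinner_on_unions C D :
  saturated (C `&` D) -> saturated D -> cinner_on PP C D = D.
Proof.
move=> sCD sD; have eCD : ~` C `&` D = ~` (C `&` D) `&` D.
  by rewrite setCI setIUl setICl setU0.
rewrite /cinner_on inner_saturated // outer_saturated; last first.
  by rewrite eCD; apply: saturatedI => //; apply: saturatedC.
by rewrite -setIUl setUv setTI.
Qed.

Lemma cinner_onC C D : cinner_on PP (~` C) D = couter_on PP C D.
Proof. by rewrite /cinner_on /couter_on setCK setUC. Qed.

End Blocks.

(** * Gains of bets on conditional events *)

Section Gains.
Context {R : realType} {Omega : Type}.
Implicit Types (A B C D : set Omega) (w : Omega) (p q s : R).

(** Unlike in [gain], the price is a free argument and [B] may be empty. *)
Definition event_gain A B p w : R := \1_B w * (\1_A w - p).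

Lemma event_gainC A B p w :
  event_gain (~` A) B (1 - p) w = - event_gain A B p w.
Proof. by rewrite /event_gain !indicE in_setC; case: (w \in A) => /=; lra. Qed.

Lemma event_gain_in A B p w : B w -> A w -> event_gain A B p w = 1 - p.
Proof. by move=> Bw Aw; rewrite /event_gain !indicE !mem_set //= mul1r. Qed.

Lemma event_gain_notin A B p w : B w -> ~ A w -> event_gain A B p w = - p.
Proof.
by move=> Bw Aw; rewrite /event_gain !indicE mem_set // memNset //= mul1r sub0r.
Qed.

Lemma event_gain_off A B p w : ~ B w -> event_gain A B p w = 0.
Proof. by move=> Bw; rewrite /event_gain !indicE memNset //= mul0r. Qed.

Lemma eq_event_gain A B A' B' p w w' :
  (B w <-> B' w') -> (B w -> (A w <-> A' w')) ->
  event_gain A B p w = event_gain A' B' p w'.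
Proof.
move=> BB' AA'; case: (pselect (B w)) => Bw; last first.
  by rewrite !event_gain_off // => /BB'.
have B'w := BB'.1 Bw; have [AA1 AA2] := AA' Bw.
case: (pselect (A w)) => Aw.
  by rewrite !event_gain_in //; apply: AA1.
by rewrite !event_gain_notin // => /AA2.
Qed.

Lemma gain_cevent (P : cgamble R Omega -> R) A B (hB : B !=set0) w :
  gain P (cevent A hB) w = event_gain A B (P (cevent A hB)) w.
Proof.
rewrite /gain /event_gain /= /patch !indicE.
by case: (w \in B) => //; rewrite !mul0r.
Qed.

Lemma cgamble_eq (x y : cgamble R Omega) :
  cg_on x = cg_on y -> cg_fun x = cg_fun y -> x = y.
Proof.
case: x y => [B X n b o] [B' X' n' b' o'] /= eB eX.
by subst B' X'; congr CGamble; apply: Prop_irrelevance.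
Qed.

Lemma cevent_congr A A' B B' (hB : B !=set0) (hB' : B' !=set0) :
  B = B' -> A `&` B = A' `&` B' -> cevent (R := R) A hB = cevent A' hB'.
Proof.
move=> eB; subst B' => eA.
by rewrite (Prop_irrelevance hB' hB); apply: cevent_eq.
Qed.

Lemma cg_oppK : involutive (@cg_opp R Omega).
Proof.
move=> x; apply: cgamble_eq => //; apply/funext => w /=.
rewrite /patch /=; case: ifPn => wB; first by rewrite /patch wB opprK.
by rewrite cg_off //; move/negP: wB => wB Bw; apply: wB; rewrite inE.
Qed.

Lemma gain_opp (P : cgamble R Omega -> R) x w :
  gain (fun y => - P (cg_opp y)) (cg_opp x) w = - gain P x w.
Proof.
rewrite /gain cg_oppK /= /patch indicE.
case: ifP => _; last by rewrite !mul0r oppr0.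
by rewrite !mul1r opprB addrC opprK.
Qed.

End Gains.

(** * Nonnegative suprema *)

Section Sup.
Context {R : realType}.

(* An unbounded set has the junk supremum 0, so no boundedness is needed. *)
Lemma sup_ge0 (A : set R) x : A x -> 0 <= x -> 0 <= sup A.
Proof.
move=> Ax x0; case: (pselect (has_sup A)) => [[_ hA]|/sup_out -> //].
exact: le_trans x0 (ub_le_sup hA Ax).
Qed.

(** A function with finitely many values attains its supremum. *)
Lemma finite_sup_ge0 (T : Type) (I : finType) (sig : T -> I) (F : I -> R)
    (B : set T) : B !=set0 ->
  0 <= sup ((fun t => F (sig t)) @` B) -> exists2 t, B t & 0 <= F (sig t).
Proof.
move=> [t0 Bt0] sup0; apply: contrapT => H.
have F0 t : B t -> F (sig t) < 0.
  by move=> Bt; rewrite ltNge; apply/negP => Ft; apply: H; exists t.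
(* If all values on [B] are negative, the largest negative value of [F] bounds them; the default
   [F (sig t0)] is negative as well. *)
pose M := \big[Num.max/F (sig t0)]_(i | F i < 0) F i.
have M0 : M < 0 by apply: bigmax_lt => //; apply: F0.
suff : sup ((fun t => F (sig t)) @` B) <= M by lra.
apply: ge_sup; first by exists (F (sig t0)), t0.
by move=> _ [t Bt <-]; apply: le_bigmax_cond; apply: F0.
Qed.

End Sup.

(** * Consequences of coherence for bets on events *)

Section Coherence.
Context {R : realType} {Omega : Type}.
Implicit Types (A B C D : set Omega) (w : Omega) (S : set (cgamble R Omega)).

(** A combination of bets on events depends only on which of the events occur. It thus takes
    finitely many values, and coherence yields an actual point of nonnegative gain. *)
Lemma dF_coherent_events S (P : cgamble R Omega -> R) n
    (A B : 'I_n -> set Omega) (hB : forall i, B i !=set0) (s : 'I_n -> R) :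
  dF_coherent S P -> (0 < n)%N -> (forall i, S (cevent (A i) (hB i))) ->
  exists2 w, exists i, B i w &
    0 <= \sum_(i < n) s i * event_gain (A i) (B i) (P (cevent (A i) (hB i))) w.
Proof.
move=> hP n0 SAB; have := hP n (fun i => cevent (A i) (hB i)) s n0 SAB.
pose sig w := [ffun i => (w \in A i, w \in B i)].
pose F (t : {ffun 'I_n -> bool * bool}) : R := \sum_(i < n) s i *
  ((t i).2%:R * ((t i).1%:R - P (cevent (A i) (hB i)))).
have FE w : F (sig w) =
    \sum_(i < n) s i * event_gain (A i) (B i) (P (cevent (A i) (hB i))) w.
  by apply: eq_bigr => i _; rewrite ffunE /event_gain !indicE.
rewrite /= (_ : (fun w => _) = (fun w => F (sig w))); last first.
  by apply/funext => w; rewrite FE; apply: eq_bigr => i _; rewrite gain_cevent.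
case/finite_sup_ge0.
  by have [w Bw] := hB (Ordinal n0); exists w, (Ordinal n0).
by move=> w [i _ Bw] Fw; exists w; [exists i|rewrite -FE].
Qed.

(** A unit bet against [A|B] gives the lower bound, a unit bet on it the upper one. *)
Lemma dF_coherent_event_bounds S (P : cgamble R Omega -> R) A B (hB : B !=set0) :
  dF_coherent S P -> S (cevent A hB) -> 0 <= P (cevent A hB) <= 1.
Proof.
move=> hP SA.
have key s := dF_coherent_events _ _ 1 (fun=> A) (fun=> B) (fun=> hB) s hP isT
  (fun=> SA).
have [w [_ Bw]] := key (fun=> -1); have [w' [_ Bw']] := key (fun=> 1).
rewrite !big_ord1 /event_gain !indicE (mem_set Bw) (mem_set Bw').
by case: (w \in A); case: (w' \in A) => /=; lra.
Qed.

Lemma dF_coherent_eq S (P Q : cgamble R Omega -> R) :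
  extends S P Q -> dF_coherent S P -> dF_coherent S Q.
Proof.
move=> PQ hP n x s n0 Sx; have := hP n x s n0 Sx => /=.
rewrite (_ : (fun w => \sum_(i < n) s i * gain P (x i) w) =
             (fun w => \sum_(i < n) s i * gain Q (x i) w)) //.
by apply/funext => w; apply: eq_bigr => i _; rewrite /gain PQ.
Qed.

(* The junk value 0 is taken when [B] is empty. *)
Definition Pr (P : cgamble R Omega -> R) A B : R :=
  if pselect (B !=set0) is left hB then P (cevent A hB) else 0.

Lemma PrE P A B (hB : B !=set0) : Pr P A B = P (cevent A hB).
Proof.
rewrite /Pr; case: pselect => // hB'; by rewrite (Prop_irrelevance hB' hB).
Qed.

(** * Probability values on the algebra and on inner events *)

Context {PP : set (set Omega)} (hPP : partition PP id [set: Omega]).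
Context {P : cgamble R Omega -> R} (hP : dF_coherent (ACset R PP) P).

Local Notation saturated := (saturated (PP := PP)).
Local Notation same_block := (same_block (PP := PP)).

Lemma ACset_cevent A B (hB : B !=set0) :
  saturated A -> saturated B -> ACset R PP (cevent A hB).
Proof. by move=> /unionsP - /(_ hPP) ? /unionsP - /(_ hPP) ?; exists A, B, hB. Qed.

Lemma ACset_saturated x : ACset R PP x -> exists A B (hB : B !=set0),
  [/\ saturated A, saturated B & x = cevent A hB].
Proof.
move=> [A [B [hB [sA sB ->]]]]; exists A, B, hB.
by split=> //; apply/(unionsP hPP).
Qed.

Lemma Pr_bounds A B : saturated A -> saturated B -> B !=set0 ->
  0 <= Pr P A B <= 1.
Proof.
move=> sA sB hB; rewrite (PrE _ _ _ hB).
by apply: dF_coherent_event_bounds hP _; apply: ACset_cevent.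
Qed.

Lemma Pr_coherent n (J : pred 'I_n) (A B : 'I_n -> set Omega) (s : 'I_n -> R)
    A0 B0 s0 :
  saturated A0 -> saturated B0 -> B0 !=set0 ->
  (forall i, J i -> [/\ saturated (A i), saturated (B i) & B i !=set0]) ->
  exists2 w, B0 w \/ (exists2 i, J i & B i w) &
    0 <= \sum_(i < n | J i) s i * event_gain (A i) (B i) (Pr P (A i) (B i)) w
         + s0 * event_gain A0 B0 (Pr P A0 B0) w.
Proof.
move=> sA0 sB0 hB0 hJ.
(* Index [ord0] carries the bet with stake [s0]. Indices outside [J] are filled with copies of
   [A0|B0] at stake 0, which change neither the gain nor the joint conditioning event. *)
pose sel T (f : 'I_n -> T) (f0 : T) (k : 'I_n.+1) : T :=
  if unlift ord0 k is Some i then if J i then f i else f0 else f0.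
pose AA := sel _ A A0; pose BB := sel _ B B0.
have hAB k : [/\ saturated (AA k), saturated (BB k) & BB k !=set0].
  by rewrite /AA /BB /sel; case: (unlift _ _) => // i; case: ifP => // /hJ.
pose hBB k : BB k !=set0 := let: And3 _ _ h := hAB k in h.
pose ss (k : 'I_n.+1) : R :=
  if unlift ord0 k is Some i then if J i then s i else 0 else s0.
have [||w [k Bkw]] := dF_coherent_events _ P _ AA BB hBB ss hP.
- by [].
- by move=> k; have [sA sB _] := hAB k; apply: ACset_cevent.
rewrite big_ord_recl => G0; exists w.
  move: Bkw; rewrite /BB /sel; case: (unlift _ _) => [i|]; last by left.
  by case: ifP => Ji Bw; [right; exists i|left].
apply: (le_trans G0); rewrite addrC le_eqVlt; apply/orP; left.
apply/eqP; congr (_ + _).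
  rewrite [RHS]big_mkcond /=; apply: eq_bigr => i _.
  rewrite -PrE /ss /AA /BB /sel liftK; case: ifP => // _; by rewrite mul0r.
by rewrite -PrE /ss /AA /BB /sel unlift_none.
Qed.

(** Equal stakes on both events give a gain that is constant on [B]; stakes of both signs force this
    constant to be zero. *)
Lemma Pr_complement A A' B : saturated A -> saturated A' -> saturated B ->
  B !=set0 -> (forall w, B w -> A' w <-> ~ A w) -> Pr P A' B = 1 - Pr P A B.
Proof.
move=> sA sA' sB hB AA'.
have key s := Pr_coherent 1 predT (fun=> A') (fun=> B) (fun=> s) A B s sA sB hB
  (fun _ _ => And3 sA' sB hB).
have gE w : B w -> event_gain A' B (Pr P A' B) w + event_gain A B (Pr P A B) w =
    1 - Pr P A' B - Pr P A B.
  move=> Bw; have [A1 A2] := AA' w Bw; case: (pselect (A w)) => Aw.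
    have nA'w : ~ A' w by move=> /A1.
    by rewrite event_gain_notin // event_gain_in //; lra.
  have A'w : A' w by exact: A2.
  by rewrite event_gain_in // event_gain_notin //; lra.
have [w Bw] := key 1; have [w' Bw'] := key (-1).
have {}Bw : B w by case: Bw => [|[]].
have {}Bw' : B w' by case: Bw' => [|[]].
by rewrite !big_ord1; have := gE w Bw; have := gE w' Bw'; lra.
Qed.

(** Free of any proof of nontriviality, so that it also applies to trivial events of the algebra. *)
Definition inner_value C D : R := Pr P (inner PP (C `&` D)) (cinner_on PP C D).

Definition inner_gain C D w : R :=
  event_gain (inner PP (C `&` D)) (cinner_on PP C D) (inner_value C D) w.

Lemma inner_value_bounds C D : cinner_on PP C D !=set0 ->
  0 <= inner_value C D <= 1.
Proof.
move=> h; apply: Pr_bounds => //.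
  exact: saturated_inner.
exact: saturated_cinner_on.
Qed.

(** Within [couter_on PP C D] the inner event of [~C|D] and the outer event of [C|D] are
    complementary. This conjugacy reduces upper statements to lower ones. *)
Lemma inner_valueC C D : couter_on PP C D !=set0 ->
  inner_value (~` C) D = 1 - Pr P (outer PP (C `&` D)) (couter_on PP C D).
Proof.
move=> h; rewrite /inner_value cinner_onC; apply: Pr_complement => //.
- exact: saturated_outer.
- exact: saturated_inner.
- by rewrite -cinner_onC; apply: saturated_cinner_on.
move=> w; rewrite /couter_on => Bw; split=> [/(innerP hPP) H /outerP|].
  by move=> [w' /H[nC _] [C' _]].
by case: Bw.
Qed.

Lemma inner_value_unions C D (hD : D !=set0) :
  saturated (C `&` D) -> saturated D -> inner_value C D = P (cevent C hD).
Proof.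
move=> sCD sD; have e := cinner_on_unions hPP _ _ sCD sD.
have h : cinner_on PP C D !=set0 by rewrite e.
rewrite /inner_value (PrE _ _ _ h); congr P; apply: cevent_congr => //.
by rewrite e inner_saturated // -setIA setIid.
Qed.

Lemma inner_gain_block C D w w' :
  same_block w w' -> inner_gain C D w = inner_gain C D w'.
Proof.
move=> ww'; have w'w := same_block_sym _ _ ww'.
apply: eq_event_gain => [|_]; split.
- exact: saturated_cinner_on ww'.
- exact: saturated_cinner_on w'w.
- exact: saturated_inner ww'.
- exact: saturated_inner w'w.
Qed.

(** * Comparison with bets on inner events, and the resulting coherence *)

Variant inner_spec C D w : Prop :=
| InnerIn of inner PP (C `&` D) w & D w & C w
| InnerOut of ~ inner PP (C `&` D) w & outer PP (~` C `&` D) w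
| InnerOff of ~ cinner_on PP C D w & (D w -> C w).

Lemma inner_cases C D w : inner_spec C D w.
Proof.
case: (pselect (inner PP (C `&` D) w)) => Iw.
  have [Cw Dw] : (C `&` D) w.
    by move/(innerP hPP): (Iw); apply; apply: same_block_refl.
  exact: InnerIn.
case: (pselect (outer PP (~` C `&` D) w)) => Ow; first exact: InnerOut.
apply: InnerOff; first by case.
move=> Dw; apply: contrapT => Cw; apply: Ow; apply/outerP.
by exists w => //; apply: same_block_refl.
Qed.

(** If the inner bet is won, so is [C|D]; if it is lost, its gain [- q] is the least possible; if it
    is called off, [C|D] is won or called off. *)
Lemma inner_gain_le C D w : cinner_on PP C D !=set0 ->
  inner_gain C D w <= event_gain C D (inner_value C D) w.
Proof.
move=> /inner_value_bounds; rewrite /inner_gain.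
set q := inner_value C D => q01.
case: (inner_cases C D w) => [Iw Dw Cw|Iw Ow|Nw DC].
- by rewrite !event_gain_in //; left.
- rewrite (event_gain_notin (inner _ _)) //; last by right.
  by rewrite /event_gain !indicE; case: (w \in D); case: (w \in C) => /=; lra.
- rewrite (event_gain_off (inner _ _)) //.
  case: (pselect (D w)) => Dw; last by rewrite event_gain_off.
  by rewrite event_gain_in //; [lra|exact: DC].
Qed.

(** Every case of [inner_gain_le] becomes strict where one of the bets is active: from [0 <= p],
    [p < q] and [q <= 1] follow [0 < q] and [p < 1]. *)
Lemma inner_gain_lt C D p w : cinner_on PP C D !=set0 ->
  0 <= p -> p < inner_value C D -> cinner_on PP C D w \/ D w ->
  inner_gain C D w < event_gain C D p w.
Proof.
move=> /inner_value_bounds; rewrite /inner_gain.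
set q := inner_value C D => q01 p0 pq.
case: (inner_cases C D w) => [Iw Dw Cw _|Iw Ow _|Nw DC].
- by rewrite !event_gain_in //; [lra|left].
- rewrite (event_gain_notin (inner _ _)) //; last by right.
  by rewrite /event_gain !indicE; case: (w \in D); case: (w \in C) => /=; lra.
- case=> // Dw; rewrite (event_gain_off (inner _ _)) //.
  by rewrite event_gain_in //; [lra|exact: DC].
Qed.

Lemma inner_gain_unions C D w : saturated (C `&` D) -> saturated D ->
  inner_gain C D w = event_gain C D (inner_value C D) w.
Proof.
move=> sCD sD; have e := cinner_on_unions hPP _ _ sCD sD.
apply: eq_event_gain; rewrite e // inner_saturated // => Dw.
by split=> [[]|].
Qed.

(** The free price [p0] serves two uses: the inner value itself for W-coherence, and the price of
    the new event for dF-coherent extensions. Negative stakes are harmless on the algebra, where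
    inner and original gains coincide. *)
Lemma inner_coherent n (C D : 'I_n -> set Omega) (s : 'I_n -> R) C0 D0 p0 s0 :
  cinner_on PP C0 D0 !=set0 -> inner_value C0 D0 <= p0 -> 0 <= s0 ->
  (forall i, cinner_on PP (C i) (D i) !=set0) ->
  (forall i, 0 <= s i \/ saturated (C i `&` D i) /\ saturated (D i)) ->
  exists2 w, D0 w \/ (exists i, D i w) &
    0 <= \sum_(i < n) s i * event_gain (C i) (D i) (inner_value (C i) (D i)) w
         - s0 * event_gain C0 D0 p0 w.
Proof.
move=> hB0 qp0 s00 hB hs.
pose q i := inner_value (C i) (D i).
have q01 i : 0 <= q i <= 1 := inner_value_bounds _ _ (hB i).
pose sat i := saturated (C i `&` D i) /\ saturated (D i).
(* A bet outside [J] has [s i * q i = 0] and [0 <= s i], so it never loses. *)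
pose J i := `[< sat i >] || (s i * q i != 0).
pose H w := \sum_(i < n | J i) s i * inner_gain (C i) (D i) w.
have HJ w : H w <= \sum_(i < n) s i * event_gain (C i) (D i) (q i) w.
  rewrite [leRHS](bigID J) /= -[leLHS]addr0; apply: lerD.
    apply: ler_sum => i _; have [si0|[sCD sD]] := hs i.
      by apply: ler_wpM2l => //; apply: inner_gain_le.
    by rewrite inner_gain_unions.
  apply: sumr_ge0 => i; rewrite negb_or negbK => /andP[/asboolPn nsat /eqP sq0].
  have si0 : 0 <= s i by case: (hs i) => // /nsat.
  by rewrite /event_gain mulrCA mulrBr sq0 subr0 !mulr_ge0 // indicE.
have [w Bw Hw] : exists2 w, cinner_on PP C0 D0 w \/
      (exists2 i, J i & cinner_on PP (C i) (D i) w) &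
    0 <= H w - s0 * inner_gain C0 D0 w.
  have [||||w Bw Hw] := Pr_coherent n J (fun i => inner PP (C i `&` D i))
    (fun i => cinner_on PP (C i) (D i)) s (inner PP (C0 `&` D0))
    (cinner_on PP C0 D0) (- s0).
  - exact: saturated_inner.
  - exact: saturated_cinner_on.
  - by [].
  - move=> i _; split=> //; first exact: saturated_inner.
    exact: saturated_cinner_on.
  by exists w => //; rewrite -mulNr.
have Hblock w' : same_block w w' -> H w' = H w.
  by move=> ww'; apply: eq_bigr => i _; rewrite (inner_gain_block _ _ _ _ ww').
(* As [H] is constant on the block of [w], it suffices to find a suitable point of this block in
   some original conditioning event. *)
have win w' : same_block w w' -> D0 w' \/ (exists i, D i w') ->
    0 <= H w - s0 * event_gain C0 D0 p0 w' ->
    exists2 w, D0 w \/ (exists i, D i w) &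
      0 <= \sum_(i < n) s i * event_gain (C i) (D i) (q i) w
           - s0 * event_gain C0 D0 p0 w.
  move=> ww' Dw' G0; exists w' => //; apply: le_trans G0 _.
  by rewrite lerD2r -(Hblock w').
have ww := same_block_refl hPP w.
move: Hw; rewrite /inner_gain; case: (inner_cases C0 D0 w).
(* In the two active cases, the bet against [C0|D0] at price [p0] gains at least as much as at the
   inner value, because [s0] is nonnegative. *)
- move=> Iw D0w C0w; rewrite event_gain_in //; last by left.
  by move=> Hw; apply: (win w) => //; [left|rewrite event_gain_in //; nra].
- move=> Iw Ow; rewrite event_gain_notin //; last by right.
  move=> Hw; have [w' ww' [nC0 D0w']] := (outerP _ _).1 Ow.
  by apply: (win w') => //; [left|rewrite event_gain_notin //; nra].
move=> Nw D0C0; rewrite event_gain_off // mulr0 subr0 => Hw.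
case: Bw => // -[i Ji Biw].
(* At a point of the block in some [D k] but outside [D0], the bet against [C0|D0] is called off
   too, and the total is at least [H w]. *)
case: (pselect (exists2 w', same_block w w' & (exists k, D k w') /\ ~ D0 w')).
  move=> [w' ww' [Dw' nD0]]; apply: (win w') => //; first by right.
  by rewrite event_gain_off // mulr0 subr0.
move=> nout; exfalso.
(* The block is not contained in [C0 & D0] and has no point in [D0] outside [C0]; so some point
   avoids [D0], and with it every [D k]. *)
have [w0 ww0 nDw0] : exists2 w0, same_block w w0 & forall k, ~ D k w0.
  have [w0 [ww0 nCD0]] : exists w0, same_block w w0 /\ ~ (C0 `&` D0) w0.
    apply: contrapT => Hn; apply: Nw; left; apply/(innerP hPP) => w' ww'.
    by apply: contrapT => nCD; apply: Hn; exists w'.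
  exists w0 => // k Dkw0; apply: nout; exists w0 => //.
  split; first by exists k.
  move=> D0w0; apply: Nw; right; apply/outerP; exists w0 => //; split=> //.
  by move=> C0w0; apply: nCD0.
have nI k : ~ inner PP (C k `&` D k) w.
  by move=> /(innerP hPP) /(_ _ ww0) [_ /nDw0].
(* An active bet loses [s k * q k], which is nonzero by the choice of [J]: if [C k & D k] and [D k]
   were saturated, an active bet would put [w0] in [D k]. *)
have key k : J k -> cinner_on PP (C k) (D k) w ->
    s k * inner_gain (C k) (D k) w < 0.
  move=> Jk Bk; rewrite /inner_gain event_gain_notin //.
  have nsat : ~ sat k.
    move=> [sCD sD]; move: Bk; rewrite (cinner_on_unions hPP) //.
    by move=> /(sD _ _ ww0) /nDw0.
  have sk0 : 0 <= s k by case: (hs k) => // /nsat.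
  move: Jk; rewrite /J (asboolF nsat) /= => sq.
  rewrite mulrN oppr_lt0 lt_neqAle eq_sym sq /=.
  by apply: mulr_ge0 => //; case/andP: (q01 k).
have : H w < 0; last by rewrite ltNge Hw.
rewrite /H (bigD1 i) //= -[ltRHS]addr0; apply: ltr_leD; first exact: key.
apply: sumr_le0 => k /andP[Jk _].
case: (pselect (cinner_on PP (C k) (D k) w)) => Bk; first exact/ltW/key.
by rewrite /inner_gain event_gain_off // mulr0.
Qed.

(** Only gains and conditioning events matter, so negated events are covered: the opposite of [C|D]
    at price [- p] has the gain of [~C|D] at price [1 - p]. *)
Lemma W_coherent_lower_inner S (Q : cgamble R Omega -> R) :
  (forall x, S x -> exists C D, [/\ cinner_on PP C D !=set0, cg_on x = D &
     forall w, gain Q x w = event_gain C D (inner_value C D) w]) ->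
  W_coherent_lower S Q.
Proof.
move=> hS n x0 x s0 s n0 Sx0 Sx s00 si0 /=.
have [C0 [D0 [hB0 eD0 gE0]]] := hS _ Sx0.
have /choice[C /choice[D hCD]] i := hS _ (Sx i).
have hB i : cinner_on PP (C i) (D i) !=set0 by case: (hCD i).
have [w Dw Gw] := inner_coherent n C D s C0 D0 (inner_value C0 D0) s0 hB0
  (lexx _) s00 hB (fun i => or_introl (si0 i)).
apply: sup_ge0 Gw; exists w.
  rewrite eD0; case: Dw => [|[i Di]]; [left|right] => //.
  by exists i => //; have [_ -> _] := hCD i.
rewrite gE0; congr (_ - _); apply: eq_bigr => i _.
by have [_ _ ->] := hCD i.
Qed.

(** * Representatives and complements of conditional events *)

Lemma eq_setCI C C' D : C `&` D = C' `&` D -> ~` C `&` D = ~` C' `&` D.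
Proof.
move=> e; apply/seteqP; split=> w [nC Dw]; split=> // Cw; apply: nC.
  by have [] : (C `&` D) w by rewrite e.
by have [] : (C' `&` D) w by rewrite -e.
Qed.

Lemma eq_inner_value C C' D :
  C `&` D = C' `&` D -> inner_value C D = inner_value C' D.
Proof. by move=> e; rewrite /inner_value /cinner_on e (eq_setCI _ _ _ e). Qed.

Lemma inner_valueC_unions C D (hD : D !=set0) :
  saturated C -> saturated D -> inner_value (~` C) D = 1 - P (cevent C hD).
Proof.
move=> sC sD; have sCD := saturatedI _ _ sC sD.
have sC' := saturatedC _ sC; have eD : couter_on PP C D = D.
  by rewrite -cinner_onC cinner_on_unions //; apply: saturatedI.
have hB : couter_on PP C D !=set0 by rewrite eD.
rewrite inner_valueC // (PrE _ _ _ hB); congr (_ - P _).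
apply: cevent_congr => //.
by rewrite eD outer_saturated // -setIA setIid.
Qed.

Lemma inner_gainC C D w : couter_on PP C D !=set0 -> inner_gain (~` C) D w =
  - event_gain (outer PP (C `&` D)) (couter_on PP C D)
      (Pr P (outer PP (C `&` D)) (couter_on PP C D)) w.
Proof.
move=> h; rewrite -event_gainC -inner_valueC //.
apply: eq_event_gain; rewrite cinner_onC // => Bw; split.
  by move=> /(innerP hPP) H /outerP[w' /H[nC _] [C' _]].
by case: Bw.
Qed.

(** The level set at 1 recovers a representative from the conditional gamble, so that by
    [eq_inner_value] an extension can be defined from the gamble alone. *)
Lemma cevent_level A B (hB : B !=set0) :
  [set w | cg_fun (cevent (R := R) A hB) w = 1] `&` B = A `&` B.
Proof.
apply/seteqP; split=> w [Aw Bw]; split=> //; move: Aw;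
  rewrite /= /patch mem_set // indicE.
  by case: (boolP (w \in A)) => [/set_mem//|_ /eqP]; rewrite eq_sym oner_eq0.
by move=> Aw; rewrite mem_set.
Qed.

(** * The interval of coherent extensions *)

Lemma dF_coherent_inner_le C D (hD : D !=set0) (Q : cgamble R Omega -> R) :
  cinner_on PP C D !=set0 -> cinner_on PP (~` C) D !=set0 ->
  extends (ACset R PP) P Q ->
  dF_coherent (ACset R PP `|` [set cevent C hD]) Q ->
  inner_value C D <= Q (cevent C hD) /\
  inner_value (~` C) D <= 1 - Q (cevent C hD).
Proof.
move=> hB hB' PQ hQ; set p := Q _.
have /andP[p0 p1] : 0 <= p <= 1.
  by apply: (dF_coherent_event_bounds _ _ _ _ _ hQ); right.
have p'0 : 0 <= 1 - p by rewrite subr_ge0.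
(* Coherence of [Q] for opposite stakes [s] on [A|B] and [- s] on [C|D]. *)
have bet A B (h : B !=set0) (s : R) : saturated A -> saturated B ->
    exists2 w, B w \/ D w &
      0 <= s * (event_gain A B (Pr P A B) w - event_gain C D p w).
  move=> sA sB; have sAB := ACset_cevent A B h sA sB.
  pose AA (i : 'I_2) := if i == ord0 then A else C.
  pose BB (i : 'I_2) := if i == ord0 then B else D.
  have hBB i : BB i !=set0 by rewrite /BB; case: ifP.
  pose ss (i : 'I_2) := if i == ord0 then s else - s.
  have [||w [i Bi]] := dF_coherent_events _ Q 2 AA BB hBB ss hQ; first by [].
    move=> i; move: (hBB i); rewrite /AA /BB; case: ifP => _ h'; [left|right].
      exact: ACset_cevent.
    by rewrite (Prop_irrelevance h' hD).
  rewrite big_ord_recl big_ord1 -!PrE {1 2}/AA {1 2}/BB /ss /=.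
  rewrite /AA /BB /= (PrE Q _ _ h) PQ // -(PrE P) (PrE Q _ _ hD) -/p => G0.
  exists w; last by rewrite mulrBr -mulNr.
  by move: Bi; rewrite /BB; case: ifP => _; [left|right].
(* If [C|D] is priced below its inner value, buying the inner event and selling [C|D] is a sure
   loss. The second goal is the same for [~C|D], rewritten with the outer event of [C|D]. *)
split; rewrite leNgt; apply/negP => lt.
- have [w Bw] := bet (inner PP (C `&` D)) _ hB 1 (saturated_inner hPP _)
    (saturated_cinner_on hPP _ _).
  by rewrite mul1r subr_ge0 leNgt inner_gain_lt.
- have hB'' : couter_on PP C D !=set0 by rewrite -cinner_onC.
  have sB : saturated (couter_on PP C D).
    by rewrite -cinner_onC; apply: saturated_cinner_on.
  have [w Bw] :=
    bet (outer PP (C `&` D)) _ hB'' (-1) (saturated_outer hPP _) sB.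
  rewrite mulN1r opprB subr_ge0 -lerN2 -inner_gainC // -event_gainC leNgt.
  by rewrite inner_gain_lt // cinner_onC.
Qed.

(** The sign of the total stake on the new event decides which bound is used; a positive stake on
    [C|D] is one against [~C|D]. *)
Lemma dF_coherent_extension C D (hD : D !=set0) (Q : cgamble R Omega -> R) :
  cinner_on PP C D !=set0 -> cinner_on PP (~` C) D !=set0 ->
  extends (ACset R PP) P Q ->
  inner_value C D <= Q (cevent C hD) ->
  inner_value (~` C) D <= 1 - Q (cevent C hD) ->
  dF_coherent (ACset R PP `|` [set cevent C hD]) Q.
Proof.
move=> hB hB' PQ; set c := cevent C hD => lb ub n x s n0 Sx.
case: (pselect (exists i, x i = c)) => [[i0 xi0]|nc]; last first.
  apply: (dF_coherent_eq _ _ _ PQ hP) => // i; have [//|xc] := Sx i.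
  by exfalso; apply: nc; exists i.
have /choice[C' /choice[D' hx]] i : exists C' D', [/\ cinner_on PP C' D' !=set0,
    cg_on (x i) = D' & x i <> c -> (saturated (C' `&` D') /\ saturated D') /\
      forall w, gain Q (x i) w = event_gain C' D' (inner_value C' D') w].
  have [/ACset_saturated[A [B [h [sA sB xE]]]]|->] := Sx i.
    have sAB := saturatedI _ _ sA sB.
    exists A, B; rewrite xE (cinner_on_unions hPP) //.
    split=> // _; split=> // w.
    by rewrite gain_cevent PQ ?inner_value_unions //; apply: ACset_cevent.
  by exists C, D.
have hB0 i : cinner_on PP (C' i) (D' i) !=set0 by case: (hx i).
(* Bets on [c] are gathered in the bet [t] singled out by [inner_coherent];
   they keep their place in the family, with stake 0, only to have [D] in the
   joint conditioning event. *)
pose s' i := if `[< x i = c >] then 0 else s i.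
pose t := \sum_(i < n | `[< x i = c >]) s i.
have hs' i : 0 <= s' i \/ saturated (C' i `&` D' i) /\ saturated (D' i).
  rewrite /s'; case: asboolP => xc; [by left|right].
  by have [_ _ /(_ xc)[]] := hx i.
have GE w : \sum_(i < n) s i * gain Q (x i) w =
    \sum_(i < n) s' i * event_gain (C' i) (D' i) (inner_value (C' i) (D' i)) w
    + t * event_gain C D (Q c) w.
  rewrite (bigID (fun i => `[< x i = c >])) /= addrC; congr (_ + _).
    rewrite big_mkcond /=; apply: eq_bigr => i _; rewrite /s'.
    case: asboolP => xc; first by rewrite mul0r.
    by have [_ _ /(_ xc)[_ ->]] := hx i.
  rewrite /t mulr_suml; apply: eq_bigr => i /asboolP ->.
  by rewrite gain_cevent.
suff [w Dw Gw] : exists2 w, D w \/ (exists i, D' i w) &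
    0 <= \sum_(i < n) s i * gain Q (x i) w.
  apply: sup_ge0 Gw; exists w => //; case: Dw => [Dw|[i Diw]].
    by exists i0 => //; rewrite xi0.
  by exists i => //; have [_ -> _] := hx i.
have [t0|t0] := leP t 0.
  have nt0 : 0 <= - t by rewrite oppr_ge0.
  have [w Dw Gw] := inner_coherent n C' D' s' C D (Q c) (- t) hB lb nt0 hB0 hs'.
  by exists w => //; rewrite GE -[t]opprK mulNr.
have [w Dw Gw] :=
  inner_coherent n C' D' s' (~` C) D (1 - Q c) t hB' ub (ltW t0) hB0 hs'.
by exists w => //; move: Gw; rewrite GE event_gainC mulrN opprK.
Qed.

End Coherence.

(** * Extensions to one event, and lower and upper extensions to a set of events *)

Theorem proposition8 (R : realType) (Omega : Type)
    (hOmega : [set: Omega] !=set0)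
    (PP : set (set Omega)) (hPP : partition PP id [set: Omega])
    (P : cgamble R Omega -> R) (hP : dF_coherent (ACset R PP) P) :
  (forall (C D : set Omega) (hD : D !=set0) (h : nontrivial C hD)
          (Q : cgamble R Omega -> R),
      extends (ACset R PP) P Q ->
      (dF_coherent (ACset R PP `|` [set cevent C hD]) Q <->
       P (cinner hPP h) <= Q (cevent C hD) <= P (couter hPP h)))
  /\
  (forall E : set (cgamble R Omega),
      (forall c, E c -> exists C D (hD : D !=set0),
          nontrivial (R := R) C hD /\ c = cevent C hD) ->
      ((exists Q, inner_extension hPP P E Q) /\
       (forall Q, inner_extension hPP P E Q ->
          W_coherent_lower (ACset R PP `|` E) Q)) /\
      ((exists Q, outer_extension hPP P E Q) /\
       (forall Q, outer_extension hPP P E Q ->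
          W_coherent_upper (ACset R PP `|` E) Q))).
Proof.
have innerE C D (hD : D !=set0) (h : nontrivial C hD) :
    P (cinner hPP h) = inner_value (PP := PP) (P := P) C D.
  by rewrite /inner_value (PrE _ _ _ (cinner_on_neq0 hPP h)).
have outerE C D (hD : D !=set0) (h : nontrivial C hD) :
    P (couter hPP h) = 1 - inner_value (PP := PP) (P := P) (~` C) D.
  rewrite (inner_valueC hPP hP); last exact: couter_on_neq0 h.
  by rewrite (PrE _ _ _ (couter_on_neq0 hPP h)) subKr.
have inner0 C D (hD : D !=set0) (h : nontrivial (R := R) C hD) :
    cinner_on PP C D !=set0 := cinner_on_neq0 hPP h.
have outer0 C D (hD : D !=set0) (h : nontrivial (R := R) C hD) :
    cinner_on PP (~` C) D !=set0 by rewrite cinner_onC; apply: couter_on_neq0 h.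
split=> [C D hD h Q PQ|E hE].
  have hB := inner0 _ _ _ h; have hB' := outer0 _ _ _ h.
  rewrite innerE outerE; split=> [hQ|/andP[lb ub]].
    by have := dF_coherent_inner_le hPP hP C D hD Q hB hB' PQ hQ; lra.
  by apply: (dF_coherent_extension hPP hP) => //; lra.
pose level (x : cgamble R Omega) := [set w | cg_fun x w = 1].
split; split.
(* One formula serves all events: on the algebra it returns [P], on [E] the value at the inner
   event. *)
- exists (fun x => inner_value (PP := PP) (P := P) (level x) (cg_on x)).
  have Q_cevent C D (hD : D !=set0) :
      inner_value (PP := PP) (P := P) (level (cevent C hD)) D =
      inner_value (PP := PP) (P := P) C D.
    by apply: eq_inner_value; apply: cevent_level.
  split=> [_ /(ACset_saturated hPP)[A [B [hB [sA sB ->]]]]|C D hD h _].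
    rewrite Q_cevent; apply: (inner_value_unions hPP) => //.
    exact: saturatedI.
  by rewrite innerE Q_cevent.
- move=> Q [PQ EQ]; apply: (W_coherent_lower_inner hPP hP) => x [|Ex].
    move=> /(ACset_saturated hPP)[A [B [hB [sA sB ->]]]].
    have sAB := saturatedI _ _ sA sB.
    exists A, B; rewrite (cinner_on_unions hPP) //; split=> // w.
    by rewrite gain_cevent PQ ?(inner_value_unions hPP) //; apply: ACset_cevent.
  have [C [D [hD [h xE]]]] := hE _ Ex; exists C, D; split.
  + exact: inner0 h.
  + by rewrite xE.
  + by move=> w; rewrite xE gain_cevent (EQ _ _ _ h) -?xE // innerE.
- exists (fun x => 1 - inner_value (PP := PP) (P := P) (~` level x) (cg_on x)).
  have Q_cevent C D (hD : D !=set0) :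
      inner_value (PP := PP) (P := P) (~` level (cevent C hD)) D =
      inner_value (PP := PP) (P := P) (~` C) D.
    by apply: eq_inner_value; apply: eq_setCI; apply: cevent_level.
  split=> [_ /(ACset_saturated hPP)[A [B [hB [sA sB ->]]]]|C D hD h _].
    by rewrite Q_cevent (inner_valueC_unions hPP hP _ _ hB) // subKr.
  by rewrite outerE Q_cevent.
(* Each opposite gamble is represented by the complementary event at the conjugate price. *)
- move=> Q [PQ EQ]; apply: (W_coherent_lower_inner hPP hP) => _ [x Sx <-].
  case: Sx => [|Ex].
    move=> /(ACset_saturated hPP)[A [B [hB [sA sB ->]]]].
    exists (~` A), B; split=> // [|w].
      rewrite (cinner_on_unions hPP) //.
      by apply: saturatedI => //; apply: saturatedC.
    rewrite gain_opp gain_cevent -event_gainC.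
    rewrite (inner_valueC_unions hPP hP _ _ hB) //.
    by rewrite PQ //; apply: ACset_cevent.
  have [C [D [hD [h xE]]]] := hE _ Ex; exists (~` C), D; split.
  + exact: outer0 h.
  + by rewrite xE.
  + move=> w; rewrite gain_opp xE gain_cevent (EQ _ _ _ h) -?xE // outerE.
    by rewrite -event_gainC subKr.
Qed.
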